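(* Let $\mathcal{M}$ be an $n$-dimensional $C^3$ manifold endowed with a Riemannian metric $\langle\cdot,\cdot\rangle_{\mathcal{M}}$ and let $f,g\in C^3(\mathcal{M},\mathbb{R}^n)$. Let $w_l\in\mathcal{M}$ and assume that $g(w)_t+f(w)_x=0$ is strictly hyperbolic in some neighborhood of $w_l$. Assume that the characteristic fields are normalized such that $\langle r_k,r_k\rangle_{\mathcal{M}}(w)=1$ for all $w\in\mathcal{M}$. Then the shock curves through $w_l$ can be parameterized by arc-length and, denoting the $k$-th shock curve in its arc-length parameterization by $\epsilon\mapsto w_k(\epsilon)$, they satisfy $$\dot w_k(0)=r_k(w_l)\qquad\text{and}\qquad\ddot w_k(0)=\nabla_{r_k}r_k(w_l),$$ while the shock speeds satisfy $$s_k(0)=\lambda_k(w_l)\qquad\text{and}\qquad\dot s_k(0)=\tfrac12\,r_k|_{w_l}(\lambda_k).$$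
   Context: Hyperbolicity. The system $g(w)_t+f(w)_x=0$ with states in $\mathcal{M}$ is hyperbolic if: (i) $dg|_w:T_w\mathcal{M}\to\mathbb{R}^n$ is invertible for all $w\in\mathcal{M}\setminus\Sigma$, where $\Sigma\subset\mathcal{M}$ is the union of a finite family of co-dimension one surfaces; (ii) for each $w\in\mathcal{M}\setminus\Sigma$ and $k\in\{1,\dots,n\}$ there exist $r_k(w)\in T_w\mathcal{M}$ and $\lambda_k(w)\in\mathbb{R}$ with $\lambda_k(w)\,dg|_w(r_k(w))=df|_w(r_k(w))$ and such that $r_1(w),\dots,r_n(w)$ are linearly independent; (iii) $\lambda_k$ and $r_k$ extend as $C^2$ functions to $\mathcal{M}$ such that the resulting $r_k$ are linearly independent on $\mathcal{M}$. It is strictly hyperbolic if in addition $\lambda_1(w)<\dots<\lambda_n(w)$ for all $w\in\mathcal{M}$. For $v\in T_w\mathcal{M}$, $v(\varphi)=d\varphi|_w(v)$. Shock curves. There are $n$ shock curves through $w_l$: $C^2$ curves $w_k:(-a,a)\to\mathcal{M}$, $k=1,\dots,n$, unique up to parameterization, with $w_k(0)=w_l$, which satisfy the Rankine–Hugoniot conditions $s_k(\epsilon)(g(w_k(\epsilon))-g(w_l))=f(w_k(\epsilon))-f(w_l)$ with a unique shock speed $s_k\in C^1((-a,a),\mathbb{R})$; the $k$-th one is the one tangent to the direction of $r_k(w_l)$ at $w_l$, oriented accordingly. Notation. Dot is $\frac{d}{d\epsilon}$; $\nabla$ is the Levi-Civita connection of $\langle\cdot,\cdot\rangle_{\mathcal{M}}$;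 $\ddot w_k=\nabla_{\frac{\partial}{\partial\epsilon}}\dot w_k$ is the covariant derivative of $\dot w_k$ along the curve. Arc-length parameterization means $\langle\dot w_k,\dot w_k\rangle_{\mathcal{M}}=1$.
   Formalization: The formal statement additionally assumes that dg is invertible at w_l (automatic when w_l is not in Σ); without it the claim fails, e.g. M=R, g=w^3, f=(3/4)w^4, λ=w, r=1, Σ={0}, w_l=0, where the shock speed has derivative 3/4 instead of 1/2. *)

(* Defs.v *)
From HB Require Import structures.
From mathcomp Require Import all_boot all_order all_algebra.
From mathcomp Require Import all_classical all_reals all_analysis.
From mathcomp Require Import ring.

Set Implicit Arguments.
Unset Strict Implicit.
Unset Printing Implicit Defensive.

Import Order.TTheory GRing.Theory Num.Theory.
Import numFieldNormedType.Exports.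

Local Open Scope classical_set_scope.
Local Open Scope ring_scope.

(* F is of class C^m on the open set D of a finite-dimensional space; the
   derivative is C^m when all its evaluations x |-> dF_x(v) are. *)
Fixpoint Ck (R : realType) (V W : normedModType R) (m : nat)
    (D : set V) (F : V -> W) : Prop :=
  match m with
  | 0%N => forall x, D x -> {for x, continuous F}
  | m'.+1 => (forall x, D x -> differentiable F x) /\
             (forall v, Ck m' D (fun x => 'd F x v))
  end.

(* A C^3 atlas of dimension n on the space M.  [coord i] is only meaningful on
   [dom i], and [param i], its inverse, on the open set [coord i @` dom i]. *)
Record manifold (R : realType) (n : nat) (M : topologicalType) := Manifold {
  chart : Type;
  dom : chart -> set M;
  coord : chart -> M -> 'rV[R]_n;
  param : chart -> 'rV[R]_n -> M;
  dom_open : forall i, open (dom i);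
  dom_cover : forall p, exists i, dom i p;
  image_open : forall i, open (coord i @` dom i);
  coordK : forall i p, dom i p -> param i (coord i p) = p;
  coord_continuous : forall i p, dom i p -> {for p, continuous (coord i)};
  param_continuous : forall i x, (coord i @` dom i) x ->
    {for x, continuous (param i)};
  transition_C3 : forall i j,
    Ck 3 (coord i @` (dom i `&` dom j)) (coord j \o param i);
  manifold_hausdorff : hausdorff_space M;
  manifold_second_countable : @second_countable M }.

Section Manifold.
Variables (R : realType) (n : nat) (M : topologicalType).
Variable A : manifold R n M.
Implicit Types (p q : M) (U : set M) (i j : chart A).

(* A tangent vector at p is the family of its components in the charts at p,
   related by the Jacobians of the transition maps; the entries at charts that
   do not contain p are irrelevant, hence [tangent_eq]. *)
Definition tvec := chart A -> 'rV[R]_n.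

Definition tangent_at p (v : tvec) :=
  forall i j, dom i p -> dom j p ->
    v j = 'd (coord j \o param i) (coord i p) (v i).

Definition tangent_eq p (u v : tvec) := forall i, dom i p -> u i = v i.

Definition Ck_fun (W : normedModType R) m U (h : M -> W) :=
  forall i, Ck m (coord i @` (dom i `&` U)) (h \o param i).

(* dh|_p applied to the vector with components u in the chart i *)
Definition differential (W : normedModType R) i p (h : M -> W)
    (u : 'rV[R]_n) : W :=
  'd (h \o param i) (coord i p) u.

Definition Ck_vfield m U (X : M -> tvec) :=
  (forall p, U p -> tangent_at p (X p)) /\
  (forall i, Ck m (coord i @` (dom i `&` U)) (fun x => X (param i x) i)).

Definition lin_indep p (X : 'I_n -> tvec) :=
  forall i, dom i p -> row_free (\matrix_(k < n) X k i).

(* [gram i p] is the Gram matrix of the coordinate basis of the chart i at p. *)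
Record riemannian_metric := RiemannianMetric {
  gram : chart A -> M -> 'M[R]_n;
  gram_sym : forall i p, dom i p -> (gram i p)^T = gram i p;
  gram_pos : forall i p (u : 'rV[R]_n), dom i p -> u != 0 ->
    0 < (u *m gram i p *m u^T) 0 0;
  gram_change : forall i j p (u v : 'rV[R]_n), dom i p -> dom j p ->
    let J := 'd (coord j \o param i) (coord i p) in
    (u *m gram i p *m v^T) 0 0 = (J u *m gram j p *m (J v)^T) 0 0;
  gram_C1 : forall i, Ck 1 (coord i @` dom i) (gram i \o param i) }.

Variable G : riemannian_metric.

Definition inner i p (u v : 'rV[R]_n) : R := (u *m gram G i p *m v^T) 0 0.

Definition unit_vector p (v : tvec) :=
  forall i, dom i p -> inner i p (v i) (v i) = 1.

(* partial derivative in the direction c of the (a, b) entry of the metric *)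
Definition dgram i p (c a b : 'I_n) : R :=
  'D_(delta_mx 0 c) (fun x => gram G i (param i x) a b) (coord i p).

(* [christoffel i p d a b] is Gamma^d_ab, for the Levi-Civita connection. *)
Definition christoffel i p (d a b : 'I_n) : R :=
  2^-1 * \sum_(e < n) invmx (gram G i p) d e *
    (dgram i p a b e + dgram i p b a e - dgram i p e a b).

Definition Gamma i p (u v : 'rV[R]_n) : 'rV[R]_n :=
  \row_d \sum_(a < n) \sum_(b < n) christoffel i p d a b * u 0 a * v 0 b.

(* nabla_X Y *)
Definition nabla (X Y : M -> tvec) p : tvec := fun i =>
  'd (fun x => Y (param i x) i) (coord i p) (X p i) + Gamma i p (X p i) (Y p i).

Definition Ck_curve m (J : set R) (w : R -> M) :=
  (forall t, J t -> {for t, continuous w}) /\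
  (forall i, Ck m (J `&` w @^-1` dom i) (coord i \o w)).

Definition velocity (w : R -> M) (t : R) : tvec :=
  fun i => derive1 (coord i \o w) t.

(* covariant derivative of the velocity along w *)
Definition acceleration (w : R -> M) (t : R) : tvec := fun i =>
  derive1 (fun s => velocity w s i) t
  + Gamma i (w t) (velocity w t i) (velocity w t i).

Definition unit_speed (J : set R) (w : R -> M) :=
  forall t, J t -> unit_vector (w t) (velocity w t).

(* S is an embedded C^1 hypersurface of the open set U (not nec. closed) *)
Definition hypersurface U (S : set M) :=
  S `<=` U /\
  forall p, S p -> exists (V : set M) (h : M -> R),
    [/\ open_nbhs p V, V `<=` U, Ck_fun 1 V h,
        (forall q i, V q -> dom i q -> exists u, differential i q h u != 0)
      & S `&` V = [set q | V q /\ h q = 0]].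

Definition finite_union_hypersurfaces U (Sigma : set M) :=
  exists (m : nat) (S : 'I_m -> set M),
    (forall a, hypersurface U (S a)) /\ Sigma = \bigcup_a S a.

Definition differential_invertible (g : M -> 'rV[R]_n) p :=
  forall i, dom i p -> bijective (differential i p g).

(* g(w)_t + f(w)_x = 0, with states in the open set U, singular set Sigma,
   characteristic speeds lambda and characteristic fields r *)
Definition hyperbolic U (Sigma : set M) (f g : M -> 'rV[R]_n)
    (lambda : 'I_n -> M -> R) (r : 'I_n -> M -> tvec) :=
  [/\ finite_union_hypersurfaces U Sigma,
      (forall p, (U `\` Sigma) p -> differential_invertible g p),
      (forall p k i, (U `\` Sigma) p -> dom i p ->
         lambda k p *: differential i p g (r k p i) =
         differential i p f (r k p i)),
      (forall k, Ck_fun 2 U (lambda k) /\ Ck_vfield 2 U (r k))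
    & (forall p, U p -> lin_indep p (r^~ p))].

Definition strictly_hyperbolic U Sigma f g lambda r :=
  hyperbolic U Sigma f g lambda r /\
  forall p (j k : 'I_n), U p -> (j < k)%N -> lambda j p < lambda k p.

Definition open_interval_around0 (J : set R) :=
  [/\ open J, is_interval J & J 0].

(* w is a (regular) shock curve through wl, with shock speed s, tangent at wl
   to the direction of the vector rk and oriented accordingly.  The domain is
   an arbitrary open interval around 0, such as `](-a), a[, because an
   arc-length parameterization need not live on a symmetric interval. *)
Definition shock_curve (f g : M -> 'rV[R]_n) (wl : M) (rk : tvec)
    (J : set R) (w : R -> M) (s : R -> R) :=
  [/\ open_interval_around0 J,
      Ck_curve 2 J w /\
        (forall t i, J t -> dom i (w t) -> velocity w t i != 0),
      Ck 1 J s,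
      (forall t, J t -> s t *: (g (w t) - g wl) = f (w t) - f wl)
    & w 0 = wl /\
        (exists2 c : R, 0 < c &
           tangent_eq wl (velocity w 0) (fun i => c *: rk i))].

End Manifold.

Arguments Ck_fun {R n M} A {W} m U h.
Arguments differential_invertible {R n M} A g p.
Arguments velocity {R n M} A w t i.

(* orientation-preserving C^2 change of parameter from J' onto J fixing 0 *)
Definition reparam (R : realType) (J' J : set R) (phi : R -> R) :=
  [/\ open_interval_around0 J', phi 0 = 0, phi @` J' = J, Ck 2 J' phi
    & forall t, J' t -> 0 < derive1 phi t].

(* [christoffel] is torsion-free and compatible with the metric, as the
   Levi-Civita connection has to be. *)
Section LeviCivita.
Variables (R : realType) (n : nat) (M : topologicalType).
Variables (A : manifold R n M) (G : riemannian_metric A).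
Variables (i : chart A) (p : M).
Hypothesis ip : dom i p.

Lemma gram_unit : gram G i p \in unitmx.
Proof.
rewrite -row_free_unit -kermx_eq0; apply/negPn/negP => /rowV0Pn[u].
move=> /sub_kermxP uG /(gram_pos G ip).
by rewrite uG mul0mx mxE ltxx.
Qed.

Lemma dgram_sym c a b : dgram G i p c a b = dgram G i p c b a.
Proof.
apply: near_eq_derive.
have := open_nbhs_nbhs (conj (@image_open _ _ _ A i) (ex_intro2 _ _ p ip erefl)).
apply: filterS => x [q iq <-]; rewrite coordK//.
by rewrite -{1}(gram_sym G iq) mxE.
Qed.

Lemma christoffel_torsion_free d a b :
  christoffel G i p d a b = christoffel G i p d b a.
Proof.
rewrite /christoffel; congr (_ * _); apply: eq_bigr => e _; congr (_ * _).
by rewrite (dgram_sym e a b); ring.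
Qed.

Lemma christoffel_lower a b e :
  \sum_(d < n) christoffel G i p d a b * gram G i p d e =
  2^-1 * (dgram G i p a b e + dgram G i p b a e - dgram G i p e a b).
Proof.
pose K := \row_e' (dgram G i p a b e' + dgram G i p b a e' - dgram G i p e' a b).
have H : K *m invmx (gram G i p) *m gram G i p = K.
  by rewrite -mulmxA mulVmx ?gram_unit// mulmx1.
have -> : dgram G i p a b e + dgram G i p b a e - dgram G i p e a b = K 0 e.
  by rewrite mxE.
rewrite -[in RHS]H [in RHS]mxE mulr_sumr; apply: eq_bigr => d _.
rewrite mulrA; congr (_ * _); rewrite /christoffel; congr (_ * _).
rewrite mxE; apply: eq_bigr => e' _; rewrite mxE [RHS]mulrC; congr (_ * _).
by rewrite -{1}(gram_sym G ip) -trmx_inv mxE.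
Qed.

Lemma christoffel_metric c a b :
  dgram G i p c a b =
  \sum_(d < n) christoffel G i p d c a * gram G i p d b +
  \sum_(d < n) christoffel G i p d c b * gram G i p d a.
Proof.
by rewrite !christoffel_lower (dgram_sym c b a); field.
Qed.

End LeviCivita.

(* Main.v *)
Require Import Defs.
From HB Require Import structures.
From mathcomp Require Import all_boot all_order all_algebra.
From mathcomp Require Import all_classical all_reals all_analysis.
Import Order.TTheory GRing.Theory Num.Theory.
Import numFieldNormedType.Exports.
(* [coord] also names an operation of [vector]; the one of [Defs] is meant. *)
Import Defs.
Local Open Scope classical_set_scope.
Local Open Scope ring_scope.

Set Implicit Arguments.
Unset Strict Implicit.
Unset Printing Implicit Defensive.

(* Arc length L is a primitive of the speed, which is C^1 and positive, and the
   new parameter is its inverse.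

   For the expansion at 0, work in a chart, where the curve is x(t), and let
   d(t) = x'(t) - r_k(x(t)), which vanishes at t = 0.  Subtracting
   lambda_k dg(r_k) = df(r_k), taken along the curve, from the derivative of the
   Rankine-Hugoniot condition gives
     s' (g(x) - g(wl)) + (s - lambda_k(x)) dg_x(r_k) + s dg_x(d) = df_x(d).
   Every term has a differentiable factor that vanishes at 0, so this can be
   differentiated at 0 using only the continuity of s', s, dg and df:
     (2 s' - r_k(lambda_k)) dg(r_k) + lambda_k dg(d') = df(d').
   Expanding d' in the eigenbasis and using that the lambda_j are distinct, one
   gets 2 s' = r_k(lambda_k) and d' = c r_k.  In the same way
   <d, x' + r_k> = <x', x'> - <r_k, r_k> = 0 differentiates to <d', 2 r_k> = 0,
   so c = 0.

   The relation lambda_k dg(r_k) = df(r_k) extends from the complement of Sigma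
   to U by continuity, that complement being dense. *)

(** * Functions of class C^m of a real variable *)

Lemma Ck_subset (R : realType) (V W : normedModType R) m (D D' : set V)
    (F : V -> W) : D' `<=` D -> Ck m D F -> Ck m D' F.
Proof.
move=> sub; elim: m F => [|m IH] F /=; first by move=> cF x /sub; apply: cF.
by move=> [dF CF]; split=> [x /sub|v]; [apply: dF|apply: IH].
Qed.

(** The clauses of [Ck] concern [F] on the whole space at the points of [D], not its restriction to
    [D]; so [N] need not be a neighborhood of [x]. *)
Lemma Ck_local (R : realType) (V W : normedModType R) m (D : set V)
    (F : V -> W) :
  (forall x, D x -> exists2 N : set V, N x & Ck m N F) -> Ck m D F.
Proof.
elim: m F => [|m IH] F /= loc.
  by move=> x /loc[N Nx]; apply.
split=> [x /loc[N Nx [dF _]]|v]; first exact: dF.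
by apply: IH => x /loc[N Nx [_ CF]]; exists N.
Qed.

Lemma CkW (R : realType) (V W : normedModType R) m (D : set V) (F : V -> W) :
  Ck m.+1 D F -> Ck m D F.
Proof.
elim: m F => [|m IH] F [dF CF].
  by move=> x Dx; exact/differentiable_continuous/dF.
by split=> // v; exact: IH.
Qed.

Lemma is_derive_derive1 (R : realType) (W : normedModType R) (F : R -> W)
    (t : R) : derivable F t 1 -> is_derive t 1 F (derive1 F t).
Proof. by move=> d; rewrite derive1E; exact: derivableP. Qed.

Section CkCurve.
Variable R : realType.
Implicit Types (W : normedModType R) (D : set R).

(** [Ck] depends on the values of [F] around each point of [D]; openness turns agreement on [D] into
    agreement near each of its points. *)
Lemma Ck_eq W m D (F F' : R -> W) : open D -> (forall x, D x -> F x = F' x) ->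
  Ck m D F -> Ck m D F'.
Proof.
elim: m F F' => [|m IH] F F' oD eqF /=.
  move=> cF x Dx.
  suff : F' @ x --> F x by rewrite (eqF _ Dx).
  apply: cvg_trans (cF x Dx); apply: near_eq_cvg.
  by have := open_nbhs_nbhs (conj oD Dx); apply: filterS => y /eqF.
have nF x : D x -> {near x, F =1 F'}.
  by move=> Dx; have := open_nbhs_nbhs (conj oD Dx); apply: filterS => y /eqF.
move=> [dF CF].
have dF' x : D x -> differentiable F' x.
  move=> Dx; apply/derivable1_diffP; apply: near_eq_derivable (nF x Dx) _.
  exact/derivable1_diffP/dF.
split; [exact: dF'|move=> v; apply: (IH _ _ oD _ (CF v)) => x Dx].
rewrite -(deriveE _ (dF x Dx)) -(deriveE _ (dF' x Dx)).
by rewrite (near_eq_derive _ (nF x Dx)).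
Qed.

Lemma Ck_cst W m D (c : W) : Ck m D (cst c : R -> W).
Proof.
elim: m c => [|m IH] c /=; first by move=> x _; exact: cst_continuous.
split=> // v.
have -> : (fun x => 'd (cst c : R -> W) x v) = cst 0; last exact: IH.
by apply/funext => x; rewrite diff_cst.
Qed.

Lemma Ck_scalel W m D (k : R) (F : R -> W) : open D ->
  Ck m D F -> Ck m D (fun x => k *: F x).
Proof.
move=> oD; elim: m F => [|m IH] F /=.
  by move=> cF x Dx; apply: cvgZl_tmp; exact: cF.
move=> [dF CF]; split=> [x Dx|v]; first exact: (differentiableZ k (dF x Dx)).
have E x : D x -> k *: 'd F x v = 'd (fun y => k *: F y) x v.
  move=> Dx; have dFx := dF x Dx; rewrite -(deriveE v (differentiableZ k dFx)).
  by rewrite -(deriveE v dFx) (deriveZ k (diff_derivable dFx)).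
exact: (Ck_eq oD E (IH _ (CF v))).
Qed.

(** In one variable ['d F x v] is [v] times the derivative of [F] at [x], so a single evaluation of
    the differential determines all the others. *)
Lemma CkSP W m D (F : R -> W) : open D ->
  Ck m.+1 D F <-> (forall x, D x -> derivable F x 1) /\ Ck m D (derive1 F).
Proof.
move=> oD; split=> [[dF CF]|[dF CF]].
  split=> [x Dx|]; first exact/derivable1_diffP/dF.
  by apply: (Ck_eq oD _ (CF 1)) => x Dx; rewrite (derive1E' (dF x Dx)).
have dF' x : D x -> differentiable F x by move=> Dx; exact/derivable1_diffP/dF.
split; [exact: dF'|move=> v; apply: (Ck_eq oD _ (Ck_scalel v oD CF)) => x Dx].
by rewrite (diff1E (dF' x Dx)).
Qed.

Lemma CkS_is_derive W m D (F dF : R -> W) : open D ->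
  (forall x, D x -> is_derive x 1 F (dF x)) -> Ck m D dF -> Ck m.+1 D F.
Proof.
move=> oD FdF CdF; apply: (CkSP _ _ oD).2; split=> [x /FdF[]//|].
by apply: (Ck_eq oD _ CdF) => x /FdF[_ <-]; rewrite derive1E.
Qed.

Lemma Ck_add W m D (F H : R -> W) : open D ->
  Ck m D F -> Ck m D H -> Ck m D (fun x => F x + H x).
Proof.
move=> oD; elim: m F H => [|m IH] F H.
  by move=> cF cH x Dx; apply: cvgD; [exact: cF|exact: cH].
move=> /(CkSP _ _ oD).1 [dF CF] /(CkSP _ _ oD).1 [dH CH].
apply: (CkSP _ _ oD).2; split=> [x Dx|].
  by apply: derivableD; [exact: dF|exact: dH].
apply: (Ck_eq oD _ (IH _ _ CF CH)) => x Dx.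
by rewrite !derive1E (deriveD (dF x Dx) (dH x Dx)).
Qed.

Lemma Ck_sum W m D (I : Type) (s : seq I) (F : I -> R -> W) : open D ->
  (forall i, Ck m D (F i)) -> Ck m D (fun x => \sum_(i <- s) F i x).
Proof.
move=> oD CF; elim: s => [|i s IH].
  by under eq_fun do rewrite big_nil; exact: Ck_cst.
by under eq_fun do rewrite big_cons; exact: Ck_add.
Qed.

Lemma is_derive_scale W (a : R -> R) (F : R -> W) (x da : R) (dF : W) :
  is_derive x 1 a da -> is_derive x 1 F dF ->
  is_derive x 1 (fun y => a y *: F y) (da *: F x + a x *: dF).
Proof.
move=> ha hF.
have da' : derivable a x 1 by [].
have dF' : derivable F x 1 by [].
have ca : {for x, continuous a}.
  exact/differentiable_continuous/derivable1_diffP.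
have := @derive_val _ _ _ _ _ _ _ ha; have := @derive_val _ _ _ _ _ _ _ hF.
move=> <- <-.
have H : (fun h : R => h^-1 *: (a (h *: 1 + x) *: F (h *: 1 + x) - a x *: F x))
    @ 0^' --> 'D_1 a x *: F x + a x *: 'D_1 F x.
  (* The increment of the product is split through the intermediate term [a (h *: 1 + x) *: F x]. *)
  rewrite (_ : (fun h => _) = (fun h : R =>
     (h^-1 *: (a (h *: 1 + x) - a x)) *: F x +
     a (h *: 1 + x) *: (h^-1 *: (F (h *: 1 + x) - F x)))); last first.
    apply/funext => h; rewrite [X in _ = _ + X]scalerA [a _ * _]mulrC.
    rewrite -[X in _ = _ + X]scalerA -scalerA -scalerDr; congr (_ *: _).
    by rewrite scalerBl scalerBr [RHS]addrC [RHS]addrA subrK.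
  apply: cvgD; first by apply: cvgZr_tmp.
  apply: cvgZ => //.
  have : a (h *: 1 + x) @[h --> 0] --> a x.
    rewrite (_ : (fun h => _) = a \o shift x).
      by rewrite cvg_comp_shift add0r.
    by apply/funext => h /=; rewrite [_ *: _]mulr1.
  by apply: cvg_trans; apply: cvg_app; exact: cvg_within.
by split; [apply/cvg_ex; eexists; exact: H|exact/cvg_lim].
Qed.

Lemma Ck_scale W m D (a : R -> R) (F : R -> W) : open D ->
  Ck m D a -> Ck m D F -> Ck m D (fun x => a x *: F x).
Proof.
move=> oD; elim: m a F => [|m IH] a F.
  by move=> ca cF x Dx; apply: cvgZ; [exact: ca|exact: cF].
move=> Ca CF; have [da Cda] := (CkSP m a oD).1 Ca.
have [dF CdF] := (CkSP m F oD).1 CF.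
have H x : D x -> is_derive x 1 (fun y => a y *: F y)
    (derive1 a x *: F x + a x *: derive1 F x).
  by move=> Dx; rewrite !derive1E; apply: is_derive_scale; apply: derivableP;
    [exact: da|exact: dF].
apply: (CkSP _ _ oD).2; split=> [x /H[]//|].
have C := Ck_add oD (IH _ _ Cda (CkW CF)) (IH _ _ (CkW Ca) CdF).
apply: (Ck_eq oD _ C) => x /H Hx.
by rewrite [RHS]derive1E derive_val.
Qed.

Lemma is_derive1_comp_curve W (F : R -> W) (phi : R -> R) (t dphi : R)
    (dF : W) :
  is_derive t 1 phi dphi -> is_derive (phi t) 1 F dF ->
  is_derive t 1 (F \o phi) (dphi *: dF).
Proof.
move=> hp hF.
have dp : differentiable phi t by exact/derivable1_diffP.
have dF' : differentiable F (phi t) by exact/derivable1_diffP.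
have dc := differentiable_comp dp dF'.
split; first exact/derivable1_diffP.
rewrite -derive1E (derive1E' dc) (diff_comp dp dF') /= -(derive1E' dp).
rewrite derive1E (@derive_val _ _ _ _ _ _ _ hp) (diff1E dF') derive1E.
by rewrite (@derive_val _ _ _ _ _ _ _ hF).
Qed.

Lemma Ck_comp W m D D' (F : R -> W) (phi : R -> R) : open D -> open D' ->
  (forall t, D' t -> D (phi t)) -> Ck m D F -> Ck m D' phi ->
  Ck m D' (F \o phi).
Proof.
move=> oD oD' sub; elim: m F => [|m IH] F.
  by move=> cF cp t Dt; apply: continuous_comp; [exact: cp|exact/cF/sub].
move=> CF Cp; have [dp Cdp] := (CkSP m phi oD').1 Cp.
have [dF CdF] := (CkSP m F oD).1 CF.
have H t : D' t -> is_derive t 1 (F \o phi)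
    (derive1 phi t *: derive1 F (phi t)).
  move=> Dt; rewrite !derive1E; apply: is_derive1_comp_curve; apply: derivableP.
    exact: dp.
  exact/dF/sub.
apply: (CkSP _ _ oD').2; split=> [x /H[]//|].
have C := Ck_scale oD' Cdp (IH _ CdF (CkW Cp)).
apply: (Ck_eq oD' _ C) => x /H Hx.
by rewrite [RHS]derive1E derive_val.
Qed.

Lemma Ck_entry m D p q (F : R -> 'M[R]_(p, q)) i j : open D ->
  Ck m D F -> Ck m D (fun x => F x i j).
Proof.
move=> oD; elim: m F => [|m IH] F.
  move=> cF x Dx.
  apply: (@continuous_comp _ _ _ F (fun M : 'M[R]_(p, q) => M i j)).
    exact: cF.
  exact: matrix_normedtype.coord_continuous.
move=> /(CkSP _ _ oD).1 [dF CF]; apply: (CkSP _ _ oD).2; split=> [x Dx|].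
  exact: ((derivable_mxP _ _ _).1 (dF x Dx)).
apply: (Ck_eq oD _ (IH _ CF)) => x Dx.
by rewrite !derive1E (derive_mx (dF x Dx)) mxE.
Qed.

End CkCurve.

(** * Chain rule for functions of several variables along a curve *)

Lemma diff_delta (R : realType) n (W : normedModType R) (H : 'rV[R]_n -> W)
    p v :
  'd H p v = \sum_(a < n) v 0 a *: 'd H p (delta_mx 0 a).
Proof.
rewrite {1}(row_sum_delta v) linear_sum.
by apply: eq_bigr => a _; rewrite linearZ.
Qed.

Lemma is_derive_comp_rV (R : realType) n (W : normedModType R)
    (H : 'rV[R]_n -> W) (x : R -> 'rV[R]_n) t :
  differentiable H (x t) -> derivable x t 1 ->
  is_derive t 1 (H \o x) ('d H (x t) (derive1 x t)).
Proof.
move=> dH /derivable1_diffP dx; have dc := differentiable_comp dx dH.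
split; first exact/derivable1_diffP.
by rewrite -derive1E (derive1E' dc) (diff_comp dx dH) /= -(derive1E' dx).
Qed.

(** [Ck] controls the differential only in fixed directions, while here the direction is the moving
    velocity. Expanding it in the standard basis leaves partial derivatives at [x t] times the
    components of the velocity, which are continuous. This serves for the metric coefficients along
    a curve. *)
Lemma Ck1_comp_rV (R : realType) n (W : normedModType R)
    (H : 'rV[R]_n -> W) (x : R -> 'rV[R]_n) D D' : open D' ->
  (forall t, D' t -> D (x t)) -> Ck 1 D H -> Ck 1 D' x -> Ck 1 D' (H \o x).
Proof.
move=> oD' sub [dH CH] /(CkSP _ _ oD').1 [dx Cx].
apply: (@CkS_is_derive _ _ _ _ _
  (fun t => \sum_a (derive1 x t) 0 a *: 'd H (x t) (delta_mx 0 a))) => //.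
  move=> t Dt; rewrite -diff_delta.
  by apply: is_derive_comp_rV; [exact/dH/sub|exact: dx].
apply: Ck_sum => // a; apply: Ck_scale => //; first exact: Ck_entry.
move=> t Dt; apply: (@continuous_comp _ _ _ x (fun y => 'd H y (delta_mx 0 a))).
  exact/differentiable_continuous/derivable1_diffP/dx.
by apply: CH; exact: sub.
Qed.

Lemma Ck_mul (R : realType) m (D : set R) (a b : R -> R) : open D ->
  Ck m D a -> Ck m D b -> Ck m D (fun x => a x * b x).
Proof. by move=> oD Ca Cb; exact: (Ck_scale oD Ca Cb). Qed.

(** * Arc length *)

Lemma Ck1_inv (R : realType) : Ck 1 [set x : R | 0 < x] (fun x : R => x^-1).
Proof.
apply: (@CkS_is_derive _ _ _ _ _ (fun x : R => - x ^- 2)).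
- exact: open_gt.
- move=> x /= x0; apply: is_derive_eq.
    by apply: (@is_deriveV _ id) (is_derive_id x _); rewrite gt_eqF.
  exact: mulr1.
- move=> x /= x0; apply: cvgN; apply: cvgV.
    by rewrite expf_neq0// gt_eqF.
  exact: exprn_continuous.
Qed.

Lemma Ck1_sqrt (R : realType) : Ck 1 [set x : R | 0 < x] (@Num.sqrt R).
Proof.
apply: (@CkS_is_derive _ _ _ _ _ (fun x : R => (2 * Num.sqrt x)^-1)).
- exact: open_gt.
- move=> x /= x0; apply: cvgV; first by rewrite mulf_neq0// gt_eqF// sqrtr_gt0.
  by apply: cvgM; [exact: cvg_cst|exact: sqrt_continuous].
Qed.

Section ArcLength.
Variables (R : realType) (J : set R).
Hypothesis J0 : open_interval_around0 J.

Let oJ : open J. Proof. by case: J0. Qed.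
Let iJ : is_interval J. Proof. by case: J0. Qed.
Let zJ : J 0. Proof. by case: J0. Qed.

Lemma open_ex_lt t : J t -> exists2 a, a < t & J a.
Proof.
move=> Jt; have /nbhs_ballP[e /= e0 sub] := open_nbhs_nbhs (conj oJ Jt).
exists (t - e / 2); first by rewrite ltrBlDr ltrDl divr_gt0.
apply: sub; rewrite -ball_normE /ball_/= opprB addrC subrK.
by rewrite gtr0_norm ?divr_gt0// ltr_pdivrMr// ltr_pMr// ltr1n.
Qed.

Lemma open_ex_gt t : J t -> exists2 b, t < b & J b.
Proof.
move=> Jt; have /nbhs_ballP[e /= e0 sub] := open_nbhs_nbhs (conj oJ Jt).
exists (t + e / 2); first by rewrite ltrDl divr_gt0.
apply: sub; rewrite -ball_normE /ball_/= opprD addNKr normrN.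
by rewrite gtr0_norm ?divr_gt0// ltr_pdivrMr// ltr_pMr// ltr1n.
Qed.

(** The fundamental theorem of calculus is applied to the integral from some [a] to the left of both
    0 and [t], which differs from [L] by a constant near [t]. *)
Lemma antiderivative (sigma : R -> R) : Ck 0 J sigma ->
  exists2 L : R -> R, L 0 = 0 & forall t, J t -> is_derive t 1 L (sigma t).
Proof.
move=> csigma.
pose mu := @lebesgue_measure R.
(* The oriented integral from 0. Half-open intervals are used because they are the differences of
   the closed intervals starting at [a]. *)
pose L t := if 0 <= t then (\int[mu]_(u in `]0, t]) sigma u)%R
  else - (\int[mu]_(u in `]t, 0]) sigma u)%R.
exists L; first by rewrite /L lexx set_itvoc0 Rintegral_set0.
move=> t Jt.
(* The interval from [a] to [b] lies in [J] and has both 0 and [t] in its interior. *)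
have [a amin Ja] : exists2 a, a < Num.min 0 t & J a.
  by apply: open_ex_lt; rewrite /Num.min; case: ifP.
have [b bmax Jb] : exists2 b, Num.max 0 t < b & J b.
  by apply: open_ex_gt; rewrite /Num.max; case: ifP.
move: amin bmax; rewrite lt_min gt_max => /andP[a0 at_] /andP[b0 bt].
have int c : J c -> mu.-integrable `[a, c] (EFin \o sigma).
  move=> Jc; apply: continuous_compact_integrable; first exact: segment_compact.
  apply: continuous_in_subspaceT => x /[!inE] /=.
  rewrite in_itv/= => /andP[ax xc].
  by apply: csigma; apply: (iJ Ja Jc); rewrite ax.
pose F y := (\int[mu]_(u in `[a, y]) sigma u)%R.
have [dF F'] := continuous_FTC1_closed bt (int _ Jb) at_ (csigma _ Jt).
have hF : is_derive t 1 F (sigma t) 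
  by apply: DeriveDef; [exact: dF|rewrite -derive1E; exact: F'].
have nLF : {near t, (fun y => F y - F 0) =1 L}.
  have : open_nbhs t `]a, b[%classic.
    by split; [exact: interval_open|rewrite /= in_itv/= at_ bt].
  move=> /open_nbhs_nbhs; apply: filterS => y /=.
  rewrite in_itv/= => /andP[ay yb].
  have Jy : J y by apply: (iJ Ja Jb); rewrite !ltW.
  rewrite /L /F; case: ifPn => [y0|]; last rewrite -ltNge => y0.
    by rewrite Rintegral_itvB; [|exact: int|rewrite bnd_simp ltW|].
  rewrite -opprB; congr (- _).
  by rewrite Rintegral_itvB; [|exact: int|rewrite bnd_simp ltW..].
apply: near_eq_is_derive nLF _.
rewrite -[sigma t]subr0; exact: (is_deriveB hF (is_derive_cst (F 0) t 1)).
Qed.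

(** Positivity of [sigma] makes its primitive [L] strictly increasing, and the inverse function
    theorem in one variable gives the derivative of the inverse [phi]. *)
Lemma reparam_of_speed (sigma : R -> R) : Ck 1 J sigma ->
  (forall t, J t -> 0 < sigma t) ->
  exists (J' : set R) (phi : R -> R), reparam J' J phi /\
    forall y, J' y -> is_derive y 1 phi (sigma (phi y))^-1.
Proof.
move=> Csigma sigma0; have [L L0 dL] := antiderivative (CkW Csigma).
have cL t : J t -> {for t, continuous L}.
  move=> Jt; apply/differentiable_continuous/derivable1_diffP.
  by have [] := dL t Jt.
have L_lt x y : J x -> J y -> x < y -> L x < L y.
  move=> Jx Jy xy.
  have Jxy u : u \in `[x, y] -> J u by rewrite in_itv/=; exact: (iJ Jx Jy).
  have [||c /Jxy Jc E] := @MVT_segment _ L sigma x y (ltW xy).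
  - by move=> u /subset_itv_oo_cc/Jxy; exact: dL.
  - by apply: continuous_in_subspaceT => u /[!inE]/= /Jxy; exact: cL.
  - by rewrite -subr_gt0 E mulr_gt0 ?subr_gt0// sigma0.
have L_inj x y : J x -> J y -> L x = L y -> x = y.
  move=> Jx Jy E; have [/(L_lt _ _ Jx Jy)|/(L_lt _ _ Jy Jx)|//] := ltgtP x y;
    by rewrite E ltxx.
(* The inverse of [L] on its image [J']; elsewhere it takes the default value 0. *)
pose phi y := xget 0 [set t | J t /\ L t = y].
have phiK t : J t -> phi (L t) = t.
  move=> Jt; have := @xgetPex _ 0 [set u | J u /\ L u = L t].
  by case=> [|Jp E]; [exists t|apply: L_inj].
have nJ t : J t -> \forall u \near t, J u.
  by move=> Jt; exact: open_nbhs_nbhs.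
pose J' := L @` J.
have dphi y : J' y -> is_derive y 1 phi (sigma (phi y))^-1.
  move=> [t Jt <-]; rewrite (phiK _ Jt).
  apply: (@is_derive_inverse _ L phi (sigma t) t).
  - by apply: filterS (nJ t Jt) => u /phiK.
  - by apply: filterS (nJ t Jt) => u /cL.
  - exact: dL.
  - by rewrite gt_eqF// sigma0.
have Jphi y : J' y -> J (phi y) by move=> [t Jt <-]; rewrite phiK.
have cphi y : J' y -> {for y, continuous phi}.
  move=> /dphi[d _]; exact/differentiable_continuous/derivable1_diffP.
(* Near [L t] the map [phi] takes values in [J] and is a right inverse of [L], so every point there
   is in the image of [J]. *)
have oJ' : open J'.
  rewrite openE => y [t Jt <-].
  have K : \forall z \near L t, L (phi z) = z.
    apply: (near_continuous_can_sym (f := L)).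
      by apply: filterS (nJ t Jt) => u /cL.
    by apply: filterS (nJ t Jt) => u /phiK.
  have Jt' : J' (L t) by exists t.
  have : \forall z \near L t, J (phi z).
    by apply: (cphi _ Jt'); rewrite (phiK _ Jt); exact: nJ.
  by apply: filterS2 K => z Lz Jz; exists (phi z).
exists J', phi; split; last exact: dphi.
have phi0 : phi 0 = 0 by rewrite -{1}L0 phiK.
split=> //.
- split=> //; last by exists 0.
  apply/connected_intervalP/connected_continuous_connected.
    exact/connected_intervalP.
  by apply: continuous_in_subspaceT => u /[!inE]; exact: cL.
- apply/seteqP; split=> [_ [y Jy <-]|t Jt]; first exact: Jphi.
  by exists (L t); [exists t|exact: phiK].
- have Cinv : Ck 1 J ((fun x : R => x^-1) \o sigma).
    apply: (Ck_comp (@open_gt R 0) oJ) => //; exact: Ck1_inv.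
  (* Bootstrap: the derivative of [phi] is the inverse of [sigma] composed with [phi], so [phi]
     gains one order as long as [sigma] is smooth enough. Starting from continuity, two rounds give
     C^2. *)
  have up m : (m <= 1)%N -> Ck m J' phi -> Ck m.+1 J' phi.
    move=> m1 Cphi; apply: (CkS_is_derive oJ' dphi).
    apply: (Ck_comp (F := (fun x : R => x^-1) \o sigma) oJ oJ' Jphi _ Cphi).
    by case: m m1 {Cphi} => [|[|//]] _; [exact: CkW|].
  exact: (up 1%N isT (up 0%N isT cphi)).
- move=> y Jy; have [_ E] := dphi y Jy.
  by rewrite derive1E E invr_gt0; exact/sigma0/Jphi.
Qed.

End ArcLength.

(** * Speed of a curve on the manifold and its arc-length parameterization *)

Section Curves.
Variables (R : realType) (n : nat) (M : topologicalType).
Variables (A : manifold R n M) (G : riemannian_metric A).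
Implicit Types (J : set R) (w : R -> M) (i j : chart A).

Lemma innerE i p (u v : 'rV[R]_n) :
  inner G i p u v = \sum_b (\sum_a u 0 a * gram G i p a b) * v 0 b.
Proof.
by rewrite /inner mxE; apply: eq_bigr => b _; rewrite !mxE.
Qed.

Lemma open_dom_preimage J w i : open J ->
  (forall t, J t -> {for t, continuous w}) -> open (J `&` w @^-1` dom i).
Proof.
move=> oJ cw; rewrite openE => t [Jt wt].
have H1 : nbhs t J by exact: open_nbhs_nbhs.
have H2 : nbhs t (w @^-1` dom i).
  by apply: (cw t Jt); apply: open_nbhs_nbhs; split=> //; exact: dom_open.
exact: filterI H1 H2.
Qed.

Lemma differentiable_transition i j p : dom i p -> dom j p ->
  differentiable (coord j \o param i) (coord i p).
Proof. by move=> ip jp; apply: (transition_C3 i j).1; exists p. Qed.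

(** Near [t] the expression of [w] in the chart [j] is its expression in [i] followed by the
    transition map, so the chain rule gives the Jacobian relation. *)
Lemma velocity_tangent J w t : open J -> Ck_curve A 1 J w -> J t ->
  tangent_at (w t) (velocity A w t).
Proof.
move=> oJ [cw Cw] Jt i j it jt.
have oD := open_dom_preimage (i := i) oJ cw.
have [dx _] := (CkSP _ _ oD).1 (Cw i).
have dT := differentiable_transition it jt.
have H := is_derive_comp_rV (x := coord i \o w) dT (dx t (conj Jt it)).
have E : {near t, (coord j \o param i) \o (coord i \o w) =1 coord j \o w}.
  have := open_nbhs_nbhs (conj oD (conj Jt it)).
  by apply: filterS => u [_ iu] /=; rewrite coordK.
have [_ H'] := near_eq_is_derive E H.
by rewrite /velocity derive1E H'.
Qed.

Lemma inner_tangent i j p u v : dom i p -> dom j p ->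
  tangent_at p u -> tangent_at p v ->
  inner G i p (u i) (v i) = inner G j p (u j) (v j).
Proof.
move=> ip jp tu tv; rewrite /inner (gram_change G (u i) (v i) ip jp) /=.
by rewrite -(tu _ _ ip jp) -(tv _ _ ip jp).
Qed.

(** In a chart this is a polynomial in the velocity components, C^1 because the curve is C^2, and in
    the metric coefficients along the curve, C^1 because the metric is. *)
Lemma Ck1_sqr_speed J w i : open J -> Ck_curve A 2 J w ->
  Ck 1 (J `&` w @^-1` dom i)
    (fun t => inner G i (w t) (velocity A w t i) (velocity A w t i)).
Proof.
move=> oJ [cw Cw]; have oD := open_dom_preimage (i := i) oJ cw.
have Cx' := ((CkSP _ _ oD).1 (Cw i)).2.
have Cg : Ck 1 (J `&` w @^-1` dom i) ((gram G i \o param i) \o (coord i \o w)).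
  apply: (Ck1_comp_rV oD _ (gram_C1 G i)); last exact: CkW.
  by move=> t [_ it]; exists (w t).
pose v a t := derive1 (coord i \o w) t 0 a.
have C : Ck 1 (J `&` w @^-1` dom i) (fun t => \sum_b
   (\sum_a v a t * (gram G i \o param i) ((coord i \o w) t) a b) * v b t).
  have Cv a : Ck 1 (J `&` w @^-1` dom i) (v a) by exact: Ck_entry.
  apply: (Ck_sum _ oD) => b; apply: (Ck_mul oD); last exact: Cv.
  apply: (Ck_sum _ oD) => a; apply: (Ck_mul oD); first exact: Cv.
  exact: (Ck_entry a b oD Cg).
apply: (Ck_eq oD _ C) => t [_ it]; rewrite innerE /=.
by rewrite coordK.
Qed.

(** The chart is chosen separately at each [t], with no regularity in [t]; [speedE] allows any other
    chart at [w t] instead. *)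
Definition speed w t :=
  let i := sval (cid (dom_cover A (w t))) in
  Num.sqrt (inner G i (w t) (velocity A w t i) (velocity A w t i)).

Lemma speedE J w i t : open J -> Ck_curve A 1 J w -> J t -> dom i (w t) ->
  speed w t = Num.sqrt (inner G i (w t) (velocity A w t i) (velocity A w t i)).
Proof.
move=> oJ Cw Jt it; rewrite /speed; case: cid => j jt /=.
by have vt := velocity_tangent oJ Cw Jt; rewrite (inner_tangent jt it vt vt).
Qed.

Section Regular.
Variables (J : set R) (w : R -> M).
Hypothesis oJ : open J.
Hypothesis Cw : Ck_curve A 2 J w.
Hypothesis w_regular :
  forall t i, J t -> dom i (w t) -> velocity A w t i != 0.

Let Cw1 : Ck_curve A 1 J w.
Proof. by case: Cw => cw Cwi; split=> // i; exact: CkW. Qed.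

Lemma sqr_speed_gt0 t i : J t -> dom i (w t) ->
  0 < inner G i (w t) (velocity A w t i) (velocity A w t i).
Proof. by move=> Jt it; apply: gram_pos => //; exact: w_regular. Qed.

Lemma speed_gt0 t : J t -> 0 < speed w t.
Proof.
move=> Jt; have [i it] := dom_cover A (w t).
by rewrite (speedE oJ Cw1 Jt it) sqrtr_gt0 sqr_speed_gt0.
Qed.

(** Around each parameter one chart can be kept fixed, and the square root is C^1 there because the
    squared speed of a regular curve is positive. *)
Lemma Ck1_speed : Ck 1 J (speed w).
Proof.
apply: Ck_local => t Jt; have [i it] := dom_cover A (w t).
have oD := open_dom_preimage (i := i) oJ Cw.1.
exists (J `&` w @^-1` dom i) => //.
have C := Ck_comp (@open_gt R 0) oD
  (fun u (Du : (J `&` w @^-1` dom i) u) => sqr_speed_gt0 Du.1 Du.2)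
  (Ck1_sqrt R) (Ck1_sqr_speed i oJ Cw).
by apply: (Ck_eq oD _ C) => u [Ju iu]; rewrite (speedE oJ Cw1 Ju iu).
Qed.

Lemma velocity_reparam J' phi i y : open J' ->
  (forall y, J' y -> J (phi y)) -> J' y -> dom i (w (phi y)) ->
  derivable phi y 1 ->
  velocity A (w \o phi) y i = derive1 phi y *: velocity A w (phi y) i.
Proof.
move=> oJ' sub Jy iy dphi; have oD := open_dom_preimage (i := i) oJ Cw.1.
have [dx _] := (CkSP _ _ oD).1 (Cw.2 i).
have [_ H] := is_derive1_comp_curve (derivableP dphi)
  (derivableP (dx (phi y) (conj (sub _ Jy) iy))).
by rewrite /velocity !derive1E -H.
Qed.

End Regular.

Lemma inner_scale i p c (u : 'rV[R]_n) :
  inner G i p (c *: u) (c *: u) = c ^+ 2 * inner G i p u u.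
Proof.
by rewrite /inner linearZ/= -!scalemxAl -scalemxAr !mxE mulrA expr2.
Qed.

(** Symmetry of the Gram matrix cancels the mixed terms. With two unit vectors, this makes their
    difference orthogonal to their sum. *)
Lemma inner_subD j p (u v : 'rV[R]_n) : dom j p ->
  inner G j p (u - v) (u + v) = inner G j p u u - inner G j p v v.
Proof.
move=> jp; have sym : inner G j p u v = inner G j p v u.
  rewrite /inner; set m := gram G j p.
  have -> : (u *m m *m v^T) = (v *m m *m u^T)^T.
    by rewrite !trmx_mul trmxK (gram_sym G jp) mulmxA.
  by rewrite mxE.
rewrite /inner linearD /= !mulmxDr !mulmxBl mxE [X in X + _]mxE [X in _ + X]mxE.
rewrite [X in _ + X + _]mxE [X in _ + (_ + X)]mxE.
move: sym; rewrite /inner => ->.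
by rewrite addrA subrK.
Qed.

Lemma arclength_shock_curve f g wl rk J w s :
  @shock_curve R n M A f g wl rk J w s ->
  exists (J' : set R) (phi : R -> R),
    [/\ reparam J' J phi,
        shock_curve f g wl rk J' (w \o phi) (s \o phi)
      & unit_speed G J' (w \o phi)].
Proof.
move=> [J0 [Cw w0] Cs RH [wl0 [c c0 tgt]]].
have oJ : open J by case: J0.
have zJ : J 0 by case: J0.
have [J' [phi [rp dphi]]] :=
  reparam_of_speed J0 (Ck1_speed oJ Cw w0) (speed_gt0 oJ Cw w0).
have [J'0 phi0 img Cphi phi'0] := rp.
have oJ' : open J' by case: J'0.
have zJ' : J' 0 by case: J'0.
have sub y : J' y -> J (phi y) by move=> Jy; rewrite -img; exists y.
have dphi1 y : J' y -> derivable phi y 1 by move=> /dphi[].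
have cphi y : J' y -> {for y, continuous phi}.
  by move=> /dphi1 d; exact/differentiable_continuous/derivable1_diffP.
have vE i y : J' y -> dom i (w (phi y)) ->
    velocity A (w \o phi) y i = derive1 phi y *: velocity A w (phi y) i.
  by move=> Jy iy; apply: (velocity_reparam oJ Cw oJ' sub Jy iy (dphi1 _ Jy)).
have cw' y : J' y -> {for y, continuous (w \o phi)}.
  by move=> Jy; apply: continuous_comp; [exact: cphi|exact: Cw.1 (sub _ Jy)].
exists J', phi; split=> //.
- split=> //.
  + split.
      split=> // i.
      have oD := open_dom_preimage (i := i) oJ Cw.1.
      have oD' := open_dom_preimage (i := i) oJ' cw'.
      apply: (Ck_comp (F := coord i \o w) oD oD' _ (Cw.2 i)).
        by move=> y [Jy iy]; split=> //; exact: sub.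
      by apply: Ck_subset Cphi => y [].
    move=> y i Jy iy; rewrite vE// scaler_eq0 negb_or w0//; last exact: sub.
    by rewrite gt_eqF// phi'0.
  + exact: (Ck_comp oJ oJ' sub Cs (CkW Cphi)).
  + by move=> y Jy; exact: RH (sub _ Jy).
  + split; first by rewrite /= phi0.
    (* The chain rule multiplies the tangency factor by the derivative of [phi], whose positivity
       preserves the orientation. *)
    exists (derive1 phi 0 * c); first by rewrite mulr_gt0// phi'0.
    move=> i il; rewrite vE//; last by rewrite phi0 wl0.
    by rewrite phi0 (tgt i il) scalerA.
(* The velocity is divided by the old speed, so its squared length is a quotient of equal positive
   numbers. *)
- move=> y Jy i iy; rewrite vE// inner_scale.
  have [_ E] := dphi y Jy.
  have Cw1 : Ck_curve A 1 J w by case: Cw => ? H; split=> // j; exact: CkW.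
  rewrite derive1E E (speedE oJ Cw1 (sub _ Jy) iy) exprVn sqr_sqrtr.
    by rewrite mulVf// gt_eqF// (sqr_speed_gt0 w0)// ; exact: sub.
  by rewrite ltW// (sqr_speed_gt0 w0)//; exact: sub.
Qed.

End Curves.

(** * The Rankine-Hugoniot condition in a chart *)

(** Write [v] in the eigenbasis with coefficients [c]. After removing [dG], the [j]-th component of
    the equation is [c 0 j * (lam k - lam j) = mu *+ (j == k)]: the index [k] forces [mu = 0], and
    the others force [c 0 j = 0]. *)
Lemma eigen_dichotomy (R : realType) n (B : 'M[R]_n)
    (dG dF : {linear 'rV[R]_n -> 'rV[R]_n}) (lam : 'I_n -> R) k mu v :
  row_free B -> injective dG -> injective lam ->
  (forall j, dF (row j B) = lam j *: dG (row j B)) ->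
  lam k *: dG v - dF v = mu *: dG (row k B) ->
  mu = 0 /\ exists c, v = c *: row k B.
Proof.
move=> Bfree injG injlam eig E.
have Bu : B \in unitmx by rewrite -row_free_unit.
pose c := v *m invmx B.
have vE : v = \sum_j c 0 j *: row j B by rewrite -mulmx_sum_row /c mulmxKV.
(* The coordinates, in the basis of rows of [B], of the vector whose image by [dG] is the difference
   of the two sides. *)
pose d := \row_j (c 0 j * (lam k - lam j) - mu *+ (j == k)).
have dj j : d 0 j = c 0 j * (lam k - lam j) - mu *+ (j == k).
  by rewrite [LHS]mxE.
have dE : lam k *: dG v - dF v - mu *: dG (row k B) = dG (d *m B).
  have sum_delta : mu *: dG (row k B) = \sum_j (mu *+ (j == k)) *: dG (row j B).
    rewrite (bigD1 k)//= eqxx mulr1n big1 ?addr0// => j /negPf ->.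
    by rewrite mulr0n scale0r.
  rewrite mulmx_sum_row sum_delta [in LHS]vE !linear_sum /=.
  rewrite -!big_split; apply: eq_bigr => j _ /=.
  have dGZ a u : dG (a *: u) = a *: dG u by rewrite linearZ.
  have dFZ a u : dF (a *: u) = a *: dF u by rewrite linearZ.
  rewrite dj !dGZ dFZ eig.
  by rewrite [in RHS]scalerBl mulrBr scalerBl !scalerA [lam k * _]mulrC.
have d0 : d = 0.
  have : d *m B = 0 by apply: injG; rewrite -dE E subrr linear0.
  by move=> /(congr1 (mulmx^~ (invmx B))); rewrite mulmxK// mul0mx.
have d0j j : c 0 j * (lam k - lam j) = mu *+ (j == k).
  by apply/eqP; rewrite -subr_eq0 -dj d0 mxE.
have mu0 : mu = 0 by have := d0j k; rewrite subrr mulr0 eqxx mulr1n.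
split=> //; exists (c 0 k); rewrite vE (bigD1 k)//= big1 ?addr0// => j jk.
have /eqP := d0j j; rewrite mu0 mul0rn mulf_eq0 subr_eq0 => /orP[/eqP->|].
  by rewrite scale0r.
by move=> /eqP/injlam kj; rewrite kj eqxx in jk.
Qed.

(** * Derivatives at 0 of products with a vanishing factor *)

Section Vanish.
Variables (R : realType) (W : normedModType R).

(** Since [b 0 = 0], the difference quotient of the product is exactly [a] times that of [b], so
    continuity of [a] suffices. *)
Lemma is_derive_scale_vanishr (a : R -> R) (b : R -> W) (db : W) :
  {for (0 : R), continuous a} -> b 0 = 0 -> is_derive (0 : R) 1 b db ->
  is_derive (0 : R) 1 (fun t => a t *: b t) (a 0 *: db).
Proof.
move=> ca b0 [dvb <-].
have H : (fun h : R => h^-1 *: (a (h *: 1 + 0) *: b (h *: 1 + 0) - a 0 *: b 0))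
    @ 0^' --> a 0 *: 'D_1 b 0.
  rewrite (_ : (fun h => _) = (fun h : R =>
     a (h *: 1 + 0) *: (h^-1 *: (b (h *: 1 + 0) - b 0)))); last first.
    by apply/funext => h; rewrite b0 scaler0 !subr0 !scalerA mulrC.
  apply: cvgZ => //.
  rewrite (_ : (fun h => _) = a).
    by apply: cvg_trans ca; apply: cvg_app; exact: cvg_within.
  by apply/funext => h /=; rewrite addr0 [_ *: _]mulr1.
by split; [apply/cvg_ex; eexists; exact: H|exact/cvg_lim].
Qed.

Lemma is_derive_scale_vanishl (a : R -> W) (b : R -> R) (db : R) :
  {for (0 : R), continuous a} -> b 0 = 0 -> is_derive (0 : R) 1 b db ->
  is_derive (0 : R) 1 (fun t => b t *: a t) (db *: a 0).
Proof.
move=> ca b0 [dvb <-].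
have H : (fun h : R => h^-1 *: (b (h *: 1 + 0) *: a (h *: 1 + 0) - b 0 *: a 0))
    @ 0^' --> 'D_1 b 0 *: a 0.
  rewrite (_ : (fun h => _) = (fun h : R =>
     (h^-1 *: (b (h *: 1 + 0) - b 0)) *: a (h *: 1 + 0))); last first.
    by apply/funext => h; rewrite b0 scale0r !subr0 scalerA.
  apply: cvgZ => //.
  rewrite (_ : (fun h => _) = a).
    by apply: cvg_trans ca; apply: cvg_app; exact: cvg_within.
  by apply/funext => h /=; rewrite addr0 [_ *: _]mulr1.
by split; [apply/cvg_ex; eexists; exact: H|exact/cvg_lim].
Qed.

End Vanish.

Lemma is_derive_entry (R : realType) p q (F : R -> 'M[R]_(p, q)) (t : R)
    (dF : 'M[R]_(p, q)) i j :
  is_derive t 1 F dF -> is_derive t 1 (fun u => F u i j) (dF i j).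
Proof.
move=> [d <-]; split; first exact: ((derivable_mxP _ _ _).1 d).
by rewrite (derive_mx d) mxE.
Qed.

Lemma is_derive_sum_fun (R : realType) n (W : normedModType R)
    (F : 'I_n -> R -> W) (t : R) (dF : 'I_n -> W) :
  (forall i, is_derive t 1 (F i) (dF i)) ->
  is_derive t 1 (fun u => \sum_i F i u) (\sum_i dF i).
Proof.
move=> H; have -> : (fun u => \sum_i F i u) = \sum_i F i.
  by apply/funext => u; rewrite fct_sumE.
exact: is_derive_sum.
Qed.

(** In the expansion along the standard basis the vanishing factors are the components of [D], and
    the partial derivatives of [H] have only to be continuous. *)
Lemma is_derive_diff_vanish (R : realType) n (W : normedModType R)
    (H : 'rV[R]_n -> W) (x D : R -> 'rV[R]_n) (dD : 'rV[R]_n) :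
  (forall a, {for x 0, continuous (fun z => 'd H z (delta_mx 0 a))}) ->
  {for (0 : R), continuous x} -> D 0 = 0 -> is_derive (0 : R) 1 D dD ->
  is_derive (0 : R) 1 (fun t => 'd H (x t) (D t)) ('d H (x 0) dD).
Proof.
move=> cH cx D0 dD'.
have S : is_derive (0 : R) 1
    (fun t => \sum_a D t 0 a *: 'd H (x t) (delta_mx 0 a))
    (\sum_a dD 0 a *: 'd H (x 0) (delta_mx 0 a)).
  apply: is_derive_sum_fun => a.
  apply: (is_derive_scale_vanishl (b := fun t => D t 0 a)
    (a := fun t => 'd H (x t) (delta_mx 0 a))).
  - apply: (@continuous_comp _ _ _ x (fun y => 'd H y (delta_mx 0 a))).
      exact: cx.
    exact: cH.
  - by rewrite D0 mxE.
  - exact: is_derive_entry.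
apply: near_eq_is_derive (is_derive_eq S (esym (diff_delta H (x 0) dD))).
by near=> t; exact: (esym (diff_delta H (x t) (D t))).
Unshelve. all: by end_near. Qed.

Lemma continuous_diff_apply (R : realType) n (W : normedModType R)
    (T : topologicalType) (H : 'rV[R]_n -> W) (x v : T -> 'rV[R]_n) (t : T) :
  (forall a, {for x t, continuous (fun z => 'd H z (delta_mx 0 a))}) ->
  {for t, continuous x} -> {for t, continuous v} ->
  {for t, continuous (fun u => 'd H (x u) (v u))}.
Proof.
move=> cH cx cv.
have E : (fun u => \sum_a v u 0 a *: 'd H (x u) (delta_mx 0 a)) =
    (fun u => 'd H (x u) (v u)).
  by apply/funext => u; exact: (esym (diff_delta H (x u) (v u))).
suff : {for t, continuous
    (fun u => \sum_a v u 0 a *: 'd H (x u) (delta_mx 0 a))}.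
  by rewrite E.
apply: cvg_big => [|a _]; first exact: add_continuous.
apply: cvgZ.
  apply: (@continuous_comp _ _ _ v (fun M : 'rV[R]_n => M 0 a)).
    exact: cv.
  exact: matrix_normedtype.coord_continuous.
apply: (@continuous_comp _ _ _ x (fun y => 'd H y (delta_mx 0 a))).
  exact: cx.
exact: cH.
Qed.

Section LinearCancellation.
Variables (R : comNzRingType) (W : lmodType R).

(** Here [c] stands for s'(0), [d] for r_k(lambda_k), [u] for dg(r_k), and [a], [b] for the terms
    lambda_k dg(d') and df(d'). *)
Lemma second_order_cancel (c d : R) (u a b : W) :
  c *: u + (c - d) *: u + a - b = 0 -> a - b = (d - 2 * c) *: u.
Proof.
rewrite -addrA => /eqP; rewrite addrC addr_eq0 => /eqP ->.
rewrite -scalerDl -scaleNr; congr (_ *: _).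
by rewrite mulr_natl mulr2n !opprD opprK addrA addrC.
Qed.

(** Subtracts the eigenvector relation for [v = r_k] from the differentiated jump condition for
    [u = x']; [a] is the term s' (g(x) - g(wl)). *)
Lemma rankine_hugoniot_cancel (U : lmodType R) (dg df : {linear U -> W})
    (c l : R) (a : W) (u v : U) :
  a + c *: dg u = df u -> l *: dg v = df v ->
  a + (c - l) *: dg v + c *: dg (u - v) - df (u - v) = 0.
Proof.
move=> uE vE.
have -> : dg (u - v) = dg u - dg v by rewrite linearB.
have -> : df (u - v) = df u - df v by rewrite linearB.
rewrite -uE -vE scalerBl scalerBr.
apply/eqP; rewrite subr_eq0 -!addrA; apply/eqP; congr (a + _).
by rewrite addrCA [c *: dg v + _]addrC subrK addrC.
Qed.
End LinearCancellation.

(** * First and second order terms of the Rankine-Hugoniot condition at 0 *)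

Section ChartComputation.
Variables (R : realType) (n : nat) (W : normedModType R).
Variables (f g : 'rV[R]_n -> W) (r : 'rV[R]_n -> 'rV[R]_n).
Variables (lam : 'rV[R]_n -> R) (x : R -> 'rV[R]_n) (s : R -> R).
Hypothesis df : \forall z \near x 0, differentiable f z.
Hypothesis dg : \forall z \near x 0, differentiable g z.
Hypothesis cf :
  forall a, {for x 0, continuous (fun z => 'd f z (delta_mx 0 a))}.
Hypothesis cg :
  forall a, {for x 0, continuous (fun z => 'd g z (delta_mx 0 a))}.
Hypothesis dlam : differentiable lam (x 0).
Hypothesis dr : differentiable r (x 0).
Hypothesis eig : \forall z \near x 0, lam z *: 'd g z (r z) = 'd f z (r z).
Hypothesis dx : \forall t \near (0 : R), derivable x t 1.
Hypothesis ddx : derivable (derive1 x) 0 1.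
Hypothesis ds : \forall t \near (0 : R), derivable s t 1.
Hypothesis cs : {for (0 : R), continuous (derive1 s)}.
Hypothesis RH :
  \forall t \near (0 : R), s t *: (g (x t) - g (x 0)) = f (x t) - f (x 0).
Hypothesis x'0 : derive1 x 0 = r (x 0).
Hypothesis dgr_neq0 : 'd g (x 0) (r (x 0)) != 0.

Let cx : {for (0 : R), continuous x}.
Proof.
apply/differentiable_continuous/derivable1_diffP; exact: (nbhs_singleton dx).
Qed.

Lemma rankine_hugoniot_derivative : \forall t \near (0 : R),
  derive1 s t *: (g (x t) - g (x 0)) + s t *: 'd g (x t) (derive1 x t)
  = 'd f (x t) (derive1 x t).
Proof.
(* The condition holds in a neighborhood of every [t] close to 0, so it can be differentiated at
   each such [t], not only at 0. *)
have RH2 := near_join RH.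
have dfx := cx df; have dgx := cx dg.
near=> t.
have dxt : derivable x t 1 by near: t; exact: dx.
have dst : derivable s t 1 by near: t; exact: ds.
have dft : differentiable f (x t) by near: t; exact: dfx.
have dgt : differentiable g (x t) by near: t; exact: dgx.
have E : \forall u \near t, s u *: (g (x u) - g (x 0)) = f (x u) - f (x 0).
  by near: t; exact: RH2.
have H1 : is_derive t 1 (fun u => g (x u) - g (x 0)) ('d g (x t) (derive1 x t)).
  have H := is_deriveB (is_derive_comp_rV dgt dxt)
    (is_derive_cst (g (x 0)) t 1).
  exact: is_derive_eq H (subr0 ('d g (x t) (derive1 x t))).
have H2 : is_derive t 1 (fun u => f (x u) - f (x 0)) ('d f (x t) (derive1 x t)).
  have H := is_deriveB (is_derive_comp_rV dft dxt)
    (is_derive_cst (f (x 0)) t 1).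
  exact: is_derive_eq H (subr0 ('d f (x t) (derive1 x t))).
have H := near_eq_is_derive E (is_derive_scale (is_derive_derive1 dst) H1).
exact: etrans (esym (@derive_val _ _ _ _ _ _ _ H))
  (@derive_val _ _ _ _ _ _ _ H2).
Unshelve. all: by end_near. Qed.

(** At 0 the jump of [g] vanishes and the velocity is the eigenvector, which leaves (s - lambda)
    dg(r) = 0 with dg(r) nonzero. *)
Lemma shock_speed0 : s 0 = lam (x 0).
Proof.
have := nbhs_singleton rankine_hugoniot_derivative.
rewrite subrr scaler0 add0r x'0 -(nbhs_singleton eig) => /eqP.
rewrite -subr_eq0 -scalerBl scaler_eq0 (negPf dgr_neq0) orbF subr_eq0.
by move/eqP.
Qed.

Let D t := derive1 x t - r (x t).
Let D' := derive1 (derive1 x) 0 - 'd r (x 0) (r (x 0)).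

Let D0 : D 0 = 0. Proof. by rewrite /D x'0 subrr. Qed.

Let dx0 : derivable x 0 1. Proof. exact: nbhs_singleton dx. Qed.

Lemma is_derive_deviation : is_derive (0 : R) 1 D D'.
Proof.
rewrite /D' -[r (x 0) in X in _ - X]x'0 derive1E.
exact: is_deriveB (derivableP ddx) (is_derive_comp_rV dr dx0).
Qed.

Lemma second_order_rankine_hugoniot :
  lam (x 0) *: 'd g (x 0) D' - 'd f (x 0) D' =
  ('d lam (x 0) (r (x 0)) - 2 * derive1 s 0) *: 'd g (x 0) (r (x 0)).
Proof.
have dD := is_derive_deviation.
have cs0 : {for (0 : R), continuous s}.
  apply/differentiable_continuous/derivable1_diffP.
  exact: (nbhs_singleton ds).
have ds0 : derivable s 0 1 by exact: nbhs_singleton ds.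
have dg0 := nbhs_singleton dg.
have crx : {for (0 : R), continuous (r \o x)}.
  by apply: continuous_comp => //; exact: differentiable_continuous.
have s'0 := is_derive_derive1 ds0.
have gx : is_derive (0 : R) 1 (fun t => g (x t) - g (x 0))
    ('d g (x 0) (r (x 0))).
  rewrite -[X in 'd g (x 0) X]x'0.
  have H := is_deriveB (is_derive_comp_rV dg0 dx0)
    (is_derive_cst (g (x 0)) (0 : R) 1).
  exact: is_derive_eq H (subr0 _).
(* [H1] to [H4] differentiate the four terms; their vanishing factors are the jump of [g], then
   [s - lam] by [shock_speed0], then [D] twice. *)
have H1 := is_derive_scale_vanishr cs (subrr _) gx.
have slam : is_derive (0 : R) 1 (fun t => s t - lam (x t))
    (derive1 s 0 - 'd lam (x 0) (r (x 0))).
  rewrite -[X in 'd lam (x 0) X]x'0.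
  exact: is_deriveB s'0 (is_derive_comp_rV dlam dx0).
have slam0 : s 0 - lam (x 0) = 0 by rewrite shock_speed0 subrr.
have H2 := is_derive_scale_vanishl (continuous_diff_apply cg cx crx) slam0 slam.
have dgD0 : 'd g (x 0) (D 0) = 0 by rewrite D0 linear0.
have H3 := is_derive_scale_vanishr cs0 dgD0 (is_derive_diff_vanish cg cx D0 dD).
have H4 := is_derive_diff_vanish cf cx D0 dD.
have H := is_deriveB (is_deriveD (is_deriveD H1 H2) H3) H4.
have E : \forall t \near (0 : R),
    (((fun t => derive1 s t *: (g (x t) - g (x 0))) +
      (fun t => (s t - lam (x t)) *: 'd g (x t) (r (x t)))) +
      (fun t => s t *: 'd g (x t) (D t)) - (fun t => 'd f (x t) (D t))) t =
    cst 0 t.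
  have eigx := cx eig.
  near=> t; rewrite /D; apply: rankine_hugoniot_cancel.
    by near: t; exact: rankine_hugoniot_derivative.
  by near: t; exact: eigx.
have := etrans (esym (@derive_val _ _ _ _ _ _ _ (near_eq_is_derive E H)))
  (@derive_val _ _ _ _ _ _ _ (is_derive_cst (0 : W) (0 : R) 1)).
by rewrite shock_speed0; exact: second_order_cancel.
Unshelve. all: by end_near. Qed.

End ChartComputation.

(** The form is linear in [D], which vanishes at 0, so neither the metric nor [y] gets
    differentiated. *)
Lemma is_derive_quadratic_vanish (R : realType) n (gm : 'rV[R]_n -> 'M[R]_n)
    (x D y : R -> 'rV[R]_n) (dD : 'rV[R]_n) :
  {for x 0, continuous gm} -> {for (0 : R), continuous x} ->
  {for (0 : R), continuous y} -> D 0 = 0 -> is_derive (0 : R) 1 D dD ->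
  is_derive (0 : R) 1 (fun t => (D t *m gm (x t) *m (y t)^T) 0 0)
    ((dD *m gm (x 0) *m (y 0)^T) 0 0).
Proof.
move=> cgm cx cy D0 dD'.
have qE (u v : 'rV[R]_n) (m : 'M[R]_n) : (u *m m *m v^T) 0 0 =
    \sum_a u 0 a *: (\sum_b m a b * v 0 b).
  rewrite -mulmxA mxE; apply: eq_bigr => a _; congr (_ * _).
  by rewrite mxE; apply: eq_bigr => b _; rewrite [v^T _ _]mxE.
have S : is_derive (0 : R) 1
    (fun t => \sum_a D t 0 a *: (\sum_b gm (x t) a b * y t 0 b))
    (\sum_a dD 0 a *: (\sum_b gm (x 0) a b * y 0 0 b)).
  apply: is_derive_sum_fun => a.
  apply: (is_derive_scale_vanishl (b := fun t => D t 0 a)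
    (a := fun t => \sum_b gm (x t) a b * y t 0 b)).
  - apply: cvg_big => [|b _]; first exact: add_continuous.
    apply: cvgM.
      apply: (@continuous_comp _ _ _ (gm \o x) (fun m : 'M[R]_n => m a b)).
        by apply: continuous_comp; [exact: cx|exact: cgm].
      exact: matrix_normedtype.coord_continuous.
    apply: (@continuous_comp _ _ _ y (fun m : 'rV[R]_n => m 0 b)).
      exact: cy.
    exact: matrix_normedtype.coord_continuous.
  - by rewrite D0 mxE.
  - exact: is_derive_entry.
apply: near_eq_is_derive (is_derive_eq S (esym (qE _ _ _))).
by near=> t; exact: (esym (qE (D t) (y t) (gm (x t)))).
Unshelve. all: by end_near. Qed.

(** * Density of the complement of Sigma and extension of the eigenvector relation *)

Section Charts.
Variables (R : realType) (n : nat) (M : topologicalType) (A : manifold R n M).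
Implicit Types (i : chart A) (p q : M) (U O S : set M).

Lemma near_coord i p U : dom i p -> nbhs p U ->
  \forall y \near coord i p, (coord i @` (dom i `&` U)) y.
Proof.
move=> ip Up.
have imgp : (coord i @` dom i) (coord i p) by exists p.
have N1 : nbhs (coord i p) (coord i @` dom i).
  by apply: open_nbhs_nbhs; split=> //; exact: image_open.
have N2 : nbhs (coord i p) (param i @^-1` U).
  by apply: (param_continuous imgp); rewrite coordK.
apply: filterS2 N1 N2 => _ [q iq <-] /=; rewrite coordK// => Uq.
by exists q.
Qed.

Lemma Ck1_differentiable (W : normedModType R) i p U (h : M -> W) :
  dom i p -> U p -> Ck_fun A 1 U h -> differentiable (h \o param i) (coord i p).
Proof. by move=> ip Up Ch; apply: (Ch i).1; exists p. Qed.

Lemma Ck1_fun_continuous (W : normedModType R) p U (h : M -> W) :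
  open U -> U p -> Ck_fun A 1 U h -> {for p, continuous h}.
Proof.
move=> oU Up Ch; have [i ip] := dom_cover A p.
have c1 : {for p, continuous ((h \o param i) \o coord i)}.
  apply: continuous_comp; first exact: coord_continuous.
  exact: (differentiable_continuous (Ck1_differentiable ip Up Ch)).
have E : {near p, (h \o param i) \o coord i =1 h}.
  have := open_nbhs_nbhs (conj (dom_open i) ip).
  by apply: filterS => q iq /=; rewrite coordK.
suff : h @ p --> ((h \o param i) \o coord i) p by rewrite /= coordK.
by apply: cvg_trans c1; exact: near_eq_cvg.
Qed.

(** Near a point of [S] in [O], the set [S] is the zero set of a function with nonzero differential,
    which cannot vanish on a neighborhood. An open set, not just a point, is produced so that
    further hypersurfaces can be avoided. *)
Lemma hypersurface_avoid U S O : hypersurface A U S -> open O -> O !=set0 ->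
  exists Q, [/\ open Q, Q !=set0, Q `<=` O & Q `&` S = set0].
Proof.
move=> [_ HS] oO O0.
have [OS|] := eqVneq (O `&` S) set0; first by exists O; split.
move=> /set0P[p [Op Sp]]; have [V [h [[oV Vp] _ Ch regular SV]]] := HS p Sp.
(* Otherwise [h] would vanish near [p], and so would its differential at [p], against regularity. *)
have [q [Oq [Vq hq]]] : exists q, O q /\ V q /\ h q != 0.
  apply: contrapT => /forallNP noq.
  have h0 q : O q -> V q -> h q = 0.
    by move=> Oq Vq; apply/eqP/negPn/negP => hq; apply: (noq q).
  have [i ip] := dom_cover A p; have [u] := regular p i Vp ip; apply/negP/negPn.
  have NOV : nbhs p (O `&` V).
    by apply: filterI; apply: open_nbhs_nbhs.
  have near0 : \forall y \near coord i p, cst 0 y = (h \o param i) y.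
    apply: filterS (near_coord ip NOV) => _ [q [iq [Oq Vq]] <-] /=.
    by rewrite coordK// h0.
  rewrite /differential -(deriveE u (Ck1_differentiable ip Vp Ch)).
  by rewrite -(near_eq_derive _ near0) derive_cst.
have : nbhs q (O `&` V `&` [set z | h z != 0]).
  apply: filterI; first by apply: filterI; apply: open_nbhs_nbhs.
  have N : nbhs (h q) [set c : R | c != 0].
    by apply: open_nbhs_nbhs; split=> //; exact: open_neq.
  have C : h @ q --> h q := Ck1_fun_continuous oV Vq Ch.
  exact: (C _ N).
rewrite nbhsE => - [Q [oQ Qq] sub]; exists Q; split=> //.
- by exists q.
- by move=> z /sub[[]].
- apply/seteqP; split=> // z [/sub[[Oz Vz] /= hz] Sz].
  have : (S `&` V) z by [].
  by rewrite SV => - [_ hz0]; rewrite hz0 eqxx in hz.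
Qed.

(** The open set is shrunk once for each hypersurface, staying nonempty; this is the density of the
    complement. *)
Lemma finite_union_hypersurfaces_avoid U S O :
  finite_union_hypersurfaces A U S -> open O -> O !=set0 ->
  exists2 q, O q & ~ S q.
Proof.
move=> [m [F [HF ->]]] oO O0.
suff [Q [oQ [q Qq] sub dis]] : exists Q, [/\ open Q, Q !=set0, Q `<=` O &
    forall a, a \in enum 'I_m -> Q `&` F a = set0].
  exists q; first exact: sub.
  move=> [a _ Fq]; suff : (Q `&` F a) q by rewrite dis// mem_enum.
  by [].
elim: (enum 'I_m) => [|a l [P1 [oP1 P10 sub1 dis1]]]; first by exists O; split.
have [P2 [oP2 P20 sub2 dis2]] := hypersurface_avoid (HF a) oP1 P10.
exists P2; split=> //; first exact: subset_trans sub1.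
move=> b; rewrite inE => /predU1P[->//|/dis1 d].
by apply/seteqP; split=> // z [/sub2 P1z Fz]; rewrite -d.
Qed.

Lemma continuous_differential (W : normedModType R) i p U (h : M -> W)
    (X : M -> tvec A) :
  Ck_fun A 2 setT h -> Ck_vfield 2 U X -> dom i p -> U p ->
  {for coord i p, continuous (fun y => 'd (h \o param i) y (X (param i y) i))}.
Proof.
move=> Ch [_ CX] ip Up.
apply: (@continuous_diff_apply _ _ _ _ _ id).
- move=> a; have imgp : (coord i @` (dom i `&` setT)) (coord i p) by exists p.
  exact: (differentiable_continuous (((Ch i).2 (delta_mx 0 a)).1 _ imgp)).
- exact: cvg_id.
- have imgp : (coord i @` (dom i `&` U)) (coord i p) by exists p.
  exact: (differentiable_continuous ((CX i).1 _ imgp)).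
Qed.

Lemma hyperbolic_eigen U Sigma (f g : M -> 'rV[R]_n) lambda
    (r : 'I_n -> M -> tvec A) k i p :
  Ck_fun A 2 setT f -> Ck_fun A 2 setT g -> open U ->
  hyperbolic U Sigma f g lambda r -> U p -> dom i p ->
  lambda k p *: differential i p g (r k p i) = differential i p f (r k p i).
Proof.
move=> Cf Cg oU [HS _ eig Ck _] Up ip; have [Cl Cr] := Ck k.
pose Phi y := lambda k (param i y) *: 'd (g \o param i) y (r k (param i y) i) -
  'd (f \o param i) y (r k (param i y) i).
have cPhi : {for coord i p, continuous Phi}.
  have imgp : (coord i @` (dom i `&` U)) (coord i p) by exists p.
  have cl := differentiable_continuous ((Cl i).1 _ imgp).
  have cg := continuous_differential Cg Cr ip Up.
  have cf := continuous_differential Cf Cr ip Up.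
  exact: (cvgB (cvgZ cl cg) cf).
suff : Phi (coord i p) = 0.
  by rewrite /Phi coordK// => /eqP; rewrite subr_eq0 => /eqP.
(* A nonzero defect at [p] would persist on an open set, which contains a point off [Sigma], where
   the relation is given. *)
apply/eqP/negPn/negP => Phi0.
have : nbhs p [set q | [/\ U q, dom i q & Phi (coord i q) != 0]].
  have N1 : nbhs p U by exact: open_nbhs_nbhs.
  have N2 : nbhs p (dom i).
    by apply: open_nbhs_nbhs; split=> //; exact: dom_open.
  have N3 : nbhs p [set q | Phi (coord i q) != 0].
    have N : nbhs (Phi (coord i p)) [set c : 'rV[R]_n | c != 0].
      have closed0 : closed [set (0 : 'rV[R]_n)].
        exact/accessible_closed_set1/hausdorff_accessible/norm_hausdorff.
      apply: open_nbhs_nbhs; split=> //.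
      rewrite (_ : mkset _ = ~` [set 0]); first exact: closed_openC.
      by apply/seteqP; split=> c /= /eqP.
    have C1 : coord i @ p --> coord i p := coord_continuous ip.
    have C2 : Phi @ coord i p --> Phi (coord i p) := cPhi.
    exact: (C1 _ (C2 _ N)).
  by apply: filterS3 N1 N2 N3 => q.
rewrite nbhsE => - [P [oP Pp] sub].
have [q Pq Sq] := finite_union_hypersurfaces_avoid HS oP (ex_intro _ p Pp).
have [Uq iq /eqP] := sub q Pq; apply.
by rewrite /Phi coordK//; apply/eqP; rewrite subr_eq0; apply/eqP; exact: eig.
Qed.

End Charts.

(** * Expansion of the shock curve *)

Section ShockExpansion.
Variables (R : realType) (n : nat) (M : topologicalType).
Variables (A : manifold R n M) (G : riemannian_metric A).
Variables (f g : M -> 'rV[R]_n) (wl : M) (U Sigma : set M).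
Variables (lambda : 'I_n -> M -> R) (r : 'I_n -> M -> tvec A) (k : 'I_n).
Hypothesis Cf : Ck_fun A 2 setT f.
Hypothesis Cg : Ck_fun A 2 setT g.
Hypothesis oU : open U.
Hypothesis Uwl : U wl.
Hypothesis hyp : strictly_hyperbolic U Sigma f g lambda r.
Hypothesis dg_inv : differential_invertible A g wl.
Hypothesis r_unit : forall p, U p -> unit_vector G p (r k p).
Variables (J : set R) (w : R -> M) (s : R -> R).
Hypothesis shock : shock_curve f g wl (r k wl) J w s.
Hypothesis w_unit : unit_speed G J w.
Variable i : chart A.
Hypothesis iwl : dom i wl.

Let J0 : J 0. Proof. by case: shock => -[]. Qed.
Let oJ : open J. Proof. by case: shock => -[]. Qed.
Let Cw : Ck_curve A 2 J w. Proof. by case: shock => _ []. Qed.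
Let w0 : w 0 = wl. Proof. by case: shock => _ _ _ _ []. Qed.

(** Both vectors have length 1, so the tangency factor squares to 1, and orientation excludes -1. *)
Lemma velocity0 : velocity A w 0 i = r k wl i.
Proof.
have [_ _ _ _ [_ [c c0 /(_ i iwl) vc]]] := shock.
have iw0 : dom i (w 0) by rewrite w0.
have := w_unit J0 iw0.
rewrite vc inner_scale w0 (r_unit Uwl iwl) mulr1 => c2.
have /eqP := c2; rewrite sqrf_eq1 => /orP[/eqP->|/eqP cN].
  by rewrite scale1r.
by rewrite cN ltr0N1 in c0.
Qed.

Let x := coord i \o w.
Let rx y := r k (param i y) i.
Let gm := gram G i \o param i.

Let x0E : x 0 = coord i wl. Proof. by rewrite /x /= w0. Qed.
Let wx0 : param i (x 0) = wl. Proof. by rewrite x0E coordK. Qed.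

Let D t := derive1 x t - rx (x t).
Let D' := derive1 (derive1 x) 0 - 'd rx (x 0) (rx (x 0)).

Let oJi : open (J `&` w @^-1` dom i).
Proof. by apply: open_dom_preimage => //; case: Cw. Qed.

Let J0i : (J `&` w @^-1` dom i) 0. Proof. by split; rewrite //= w0. Qed.

Let near_J : \forall t \near (0 : R), J t /\ dom i (w t).
Proof. exact: open_nbhs_nbhs. Qed.

Let dx t : J t -> dom i (w t) -> derivable x t 1.
Proof. by move=> Jt it; apply: ((CkSP _ _ oJi).1 (Cw.2 i)).1. Qed.

Let ddx : derivable (derive1 x) 0 1.
Proof.
have := ((CkSP _ _ oJi).1 (Cw.2 i)).2 => /(CkSP _ _ oJi).1[d _].
exact: d J0i.
Qed.

Let x'0 : derive1 x 0 = rx (x 0).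
Proof. by rewrite /rx wx0 -velocity0. Qed.

Let near_x0 : \forall y \near x 0, (coord i @` (dom i `&` U)) y.
Proof. by rewrite x0E; apply: near_coord => //; apply: open_nbhs_nbhs. Qed.

Let imgx0 : (coord i @` (dom i `&` U)) (x 0).
Proof. exact: nbhs_singleton near_x0. Qed.

Let drx : differentiable rx (x 0).
Proof.
have [[_ _ _ Ck _] _] := hyp; have [_ [_ Cr]] := Ck k.
exact: (Cr i).1 _ imgx0.
Qed.

Let near_differentiable (h : M -> 'rV[R]_n) : Ck_fun A 2 setT h ->
  \forall y \near x 0, differentiable (h \o param i) y.
Proof.
move=> Ch; apply: filterS near_x0 => _ [q [iq Uq] <-].
by apply: (Ch i).1; exists q.
Qed.

Let continuous_partial (h : M -> 'rV[R]_n) : Ck_fun A 2 setT h -> forall a,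
  {for x 0, continuous (fun z => 'd (h \o param i) z (delta_mx 0 a))}.
Proof.
move=> Ch a; have img : (coord i @` (dom i `&` setT)) (x 0) by exists wl.
exact: (differentiable_continuous (((Ch i).2 (delta_mx 0 a)).1 _ img)).
Qed.

Let lam y := lambda k (param i y).

Let dlam : differentiable lam (x 0).
Proof.
have [[_ _ _ Ck _] _] := hyp; have [Cl _] := Ck k.
exact: (Cl i).1 _ imgx0.
Qed.

Let near_eigen : \forall y \near x 0,
  lam y *: 'd (g \o param i) y (rx y) = 'd (f \o param i) y (rx y).
Proof.
apply: filterS near_x0 => _ [q [iq Uq] <-].
have := hyperbolic_eigen k Cf Cg oU hyp.1 Uq iq.
by rewrite /differential /lam /rx coordK.
Qed.

Let near_RH : \forall t \near (0 : R),
  s t *: ((g \o param i) (x t) - (g \o param i) (x 0)) =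
  (f \o param i) (x t) - (f \o param i) (x 0).
Proof.
apply: filterS near_J => t [Jt it].
have [_ _ _ RH _] := shock.
by rewrite /= !coordK// ?w0//; exact: RH.
Qed.

Let ds t : J t -> derivable s t 1.
Proof. by have [_ _ Cs _ _] := shock; exact: ((CkSP _ _ oJ).1 Cs).1. Qed.

Let cs : {for (0 : R), continuous (derive1 s)}.
Proof. by have [_ _ Cs _ _] := shock; exact: ((CkSP _ _ oJ).1 Cs).2 J0. Qed.

Let dg_inj : injective ('d (g \o param i) (x 0)).
Proof. by rewrite x0E; exact: bij_inj (dg_inv iwl). Qed.

Let r_neq0 : rx (x 0) != 0.
Proof.
apply/eqP => r0; have := r_unit Uwl iwl; rewrite -[r k wl i]/(r k wl i).
have -> : r k wl i = 0 by rewrite -r0 /rx wx0.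
by rewrite /inner !mul0mx mxE => /esym/eqP; rewrite oner_eq0.
Qed.

Let dgr_neq0 : 'd (g \o param i) (x 0) (rx (x 0)) != 0.
Proof.
by apply/eqP => H; have /eqP := r_neq0; apply; apply: dg_inj; rewrite H linear0.
Qed.

Let near_dx : \forall t \near (0 : R), derivable x t 1.
Proof. by apply: filterS near_J => t [Jt it]; exact: dx. Qed.

Let near_ds : \forall t \near (0 : R), derivable s t 1.
Proof. by apply: filterS near_J => t [Jt _]; exact: ds. Qed.

Lemma shock_speed_at0 : s 0 = lambda k wl.
Proof.
rewrite -wx0.
exact: (shock_speed0 (near_differentiable Cf) (near_differentiable Cg)
  near_eigen near_dx near_ds near_RH x'0 dgr_neq0).
Qed.

Let lambda_inj : injective (fun j => lambda j wl).
Proof.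
have [_ strict] := hyp; move=> j l E; case: (ltngtP j l) => [jl|lj|/val_inj//].
  by have := strict wl j l Uwl jl; rewrite E ltxx.
by have := strict wl l j Uwl lj; rewrite E ltxx.
Qed.

(** This is [eigen_dichotomy] for the basis of the [r j] at [wl], with [v = D'] and [mu] the left
    side of the first equation. *)
Lemma deviation_collinear :
  'd lam (x 0) (rx (x 0)) - 2 * derive1 s 0 = 0 /\ exists c, D' = c *: r k wl i.
Proof.
have [[_ _ _ _ indep] strict] := hyp.
pose B := \matrix_(j < n) r j wl i.
have rowB j : row j B = r j wl i by exact: rowK.
rewrite -rowB.
apply: (@eigen_dichotomy _ _ B ('d (g \o param i) (x 0))
  ('d (f \o param i) (x 0)) (fun j => lambda j wl)).
- exact: indep Uwl i iwl.
- exact: dg_inj.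
- exact: lambda_inj.
- move=> j; rewrite rowB x0E.
  exact: esym (hyperbolic_eigen j Cf Cg oU hyp.1 Uwl iwl).
- rewrite rowB.
  have := second_order_rankine_hugoniot (near_differentiable Cf)
    (near_differentiable Cg) (continuous_partial Cf)
    (continuous_partial Cg) dlam drx near_eigen near_dx ddx near_ds cs
    near_RH x'0 dgr_neq0.
  by rewrite -/D' {1}/lam /rx wx0.
Qed.

Lemma deviation0 : D' = 0.
Proof.
have [_ [c D'E]] := deviation_collinear.
have rwl : rx (x 0) = r k wl i by rewrite /rx wx0.
have cx : {for (0 : R), continuous x}.
  apply/differentiable_continuous/derivable1_diffP.
  exact: (nbhs_singleton near_dx).
have cgm : {for x 0, continuous gm}.
  have img : (coord i @` dom i) (x 0) by exists wl.
  exact: (differentiable_continuous ((gram_C1 G i).1 _ img)).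
have cy : {for (0 : R), continuous (fun t => derive1 x t + rx (x t))}.
  have c1 : {for (0 : R), continuous (derive1 x)}.
    exact/differentiable_continuous/derivable1_diffP.
  have c2 : {for (0 : R), continuous (rx \o x)}.
    by apply: continuous_comp; [exact: cx|exact: differentiable_continuous].
  exact: cvgD c1 c2.
have D0 : D 0 = 0 by rewrite /D x'0 subrr.
have H := is_derive_quadratic_vanish cgm cx cy D0
  (is_derive_deviation drx near_dx ddx x'0).
(* By [inner_subD] the form is the difference of two squared lengths, both equal to 1. *)
have E : \forall t \near (0 : R),
    (D t *m gm (x t) *m (derive1 x t + rx (x t))^T) 0 0 = cst 0 t.
  have Nx := cx _ near_x0.
  apply: filterS2 near_J Nx => t [Jt it] [q [iq Uq] qx].
  have wq : w t = q by rewrite -(coordK it) -(coordK iq) qx.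
  have := inner_subD G (derive1 x t) (rx (x t)) iq.
  have -> : inner G i q (derive1 x t) (derive1 x t) = 1.
    by rewrite -wq; exact: w_unit.
  have -> : inner G i q (rx (x t)) (rx (x t)) = 1.
    by rewrite /rx -qx coordK//; exact: r_unit.
  by rewrite subrr /inner /gm /= coordK// wq.
have := etrans (esym (@derive_val _ _ _ _ _ _ _ (near_eq_is_derive E H)))
  (@derive_val _ _ _ _ _ _ _ (is_derive_cst (0 : R) (0 : R) 1)).
rewrite -/D' x'0 rwl D'E /gm /= wx0.
(* At 0 both velocity and field are r_k, so the vanishing derivative is the product of c r_k with 2
   r_k, that is 2c. *)
have -> : (c *: r k wl i *m gram G i wl *m (r k wl i + r k wl i)^T) 0 0 =
    c * inner G i wl (r k wl i) (r k wl i) *+ 2.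
  by rewrite /inner -mulr2n !linearMn /= mulmxnE -!scalemxAl mxE.
rewrite r_unit// mulr1 => /eqP; rewrite mulrn_eq0 /= => /eqP ->.
by rewrite scale0r.
Qed.

(** The Christoffel terms agree because the velocity at 0 is r_k; [deviation0] equates the remaining
    coordinate derivatives. *)
Lemma acceleration0 : acceleration G w 0 i = nabla G (r k) (r k) wl i.
Proof.
have rwl : rx (x 0) = r k wl i by rewrite /rx wx0.
rewrite /acceleration /nabla velocity0 w0; congr (_ + _).
have /eqP := deviation0; rewrite /D' subr_eq0 rwl => /eqP.
by rewrite x0E.
Qed.

Lemma shock_speed_derivative0 :
  derive1 s 0 = 2^-1 * differential i wl (lambda k) (r k wl i).
Proof.
have rwl : rx (x 0) = r k wl i by rewrite /rx wx0.
have [/eqP + _] := deviation_collinear; rewrite rwl x0E subr_eq0 => /eqP E.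
by rewrite /differential -/lam E mulrA mulVf ?mul1r// pnatr_eq0.
Qed.

End ShockExpansion.

Unset Implicit Arguments.

Theorem lemma3p4 (R : realType) (n : nat) (M : topologicalType)
    (A : manifold R n M) (G : riemannian_metric A)
    (f g : M -> 'rV[R]_n) (wl : M) (U Sigma : set M)
    (lambda : 'I_n -> M -> R) (r : 'I_n -> M -> tvec A) :
  Ck_fun A 3 setT f -> Ck_fun A 3 setT g ->
  open_nbhs wl U ->
  strictly_hyperbolic U Sigma f g lambda r ->
  differential_invertible A g wl ->
  (forall k p, U p -> unit_vector G p (r k p)) ->
  forall k : 'I_n,
    (forall (J : set R) (w : R -> M) (s : R -> R),
       shock_curve f g wl (r k wl) J w s ->
       exists (J' : set R) (phi : R -> R),
         [/\ reparam J' J phi,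
             shock_curve f g wl (r k wl) J' (w \o phi) (s \o phi)
           & unit_speed G J' (w \o phi)]) /\
    (forall (J : set R) (w : R -> M) (s : R -> R),
       shock_curve f g wl (r k wl) J w s ->
       unit_speed G J w ->
       [/\ tangent_eq wl (velocity A w 0) (r k wl),
           tangent_eq wl (acceleration G w 0) (nabla G (r k) (r k) wl),
           s 0 = lambda k wl
         & forall i : chart A, dom i wl ->
             derive1 s 0 = 2^-1 * differential i wl (lambda k) (r k wl i)]).
Proof.
move=> Cf3 Cg3 [oU Uwl] hyp dg_inv r_unit k.
have Cf : Ck_fun A 2 setT f by move=> i; exact: CkW (Cf3 i).
have Cg : Ck_fun A 2 setT g by move=> i; exact: CkW (Cg3 i).
split=> [J w s shock|J w s shock w_unit].
  exact: arclength_shock_curve shock.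
split.
- by move=> i iwl; exact: (velocity0 Uwl (r_unit k) shock w_unit iwl).
- move=> i iwl.
  exact: (acceleration0 Cf Cg oU Uwl hyp dg_inv (r_unit k) shock w_unit iwl).
- have [i iwl] := dom_cover A wl.
  exact: (shock_speed_at0 Cf Cg oU Uwl hyp dg_inv (r_unit k) shock w_unit iwl).
- move=> i iwl.
  exact: (shock_speed_derivative0 Cf Cg oU Uwl hyp dg_inv (r_unit k) shock
    w_unit iwl).
Qed.
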